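(* Let $R, M, L, \Delta > 0$ and let $f : [0,R] \to \mathbb{R}$ be convex and differentiable, with $|f(x)-f(y)| \le M|x-y|$ and $|f'(x)-f'(y)| \le L|x-y|$ for all $x,y \in [0,R]$. Let $\phi = \frac{\sqrt5+1}{2}$, let $e$ be Euler's number, and let $C = \frac{eRM\ln\phi}{2\phi}$. Suppose that $n_0 = \log_\phi\left(\frac{C}{e\Delta}\right)$ is a nonnegative integer, and that $n_0$ iterations of the golden ratio method (described in the context) are performed on $[0,R]$ with an order oracle $\psi$ for $f$ with noise level $\Delta$. Let $[a_{n_0}, b_{n_0}]$ be the remaining interval and $x_0 = \frac{a_{n_0}+b_{n_0}}{2}$ its midpoint. Then $$f(x_0) - \min_{x\in[0,R]} f(x) \le \phi\,\Delta \log_\phi\left(\frac{C}{\Delta}\right).$$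
   Context: Order oracle with noise level $\Delta$: a function $\psi(x,y) = \operatorname{sign}(f(x)-f(y)+\delta(x,y))$, where $\delta$ is an arbitrary real-valued function with $|\delta(x,y)| \le \Delta$ for all $x,y$. The answer is ''$+$'' if $f(x)-f(y)+\delta(x,y) > 0$ and ''$-$'' if it is $<0$; if the quantity equals $0$, the answer may be either ''$+$'' or ''$-$''. Golden ratio method on $[a,b]$ with $\phi = \frac{\sqrt5+1}{2}$: set $a_0=a$, $b_0=b$. At iteration $i = 0,1,2,\dots$, put $s_i = b_i - \frac{b_i-a_i}{\phi}$ and $t_i = a_i + \frac{b_i-a_i}{\phi}$ (so $a_i<s_i<t_i<b_i$), and query $\psi(s_i,t_i)$. If the answer is ''$+$'', set $a_{i+1}=s_i$, $b_{i+1}=b_i$. If the answer is ''$-$'', set $a_{i+1}=a_i$, $b_{i+1}=t_i$. After $n$ iterations the remaining interval is $[a_n,b_n]$ and the output is $\frac{a_n+b_n}{2}$. *)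

(* Defs.v *)
From Stdlib Require Import Reals.
Open Scope R_scope.

Definition phi : R := (sqrt 5 + 1) / 2.

Definition Icc (a b : R) (x : R) : Prop := a <= x <= b.

(** A function on [D] is represented by a total function on [R] of which only
    the values at points of [D] are ever constrained or used. *)
Definition convex_on (f : R -> R) (D : R -> Prop) : Prop :=
  forall x y t : R, D x -> D y -> 0 <= t <= 1 ->
    f (t * x + (1 - t) * y) <= t * f x + (1 - t) * f y.

Definition lipschitz_on (K : R) (f : R -> R) (D : R -> Prop) : Prop :=
  forall x y : R, D x -> D y -> Rabs (f x - f y) <= K * Rabs (x - y).

(** [D_in] is the derivative relative to the domain [D], hence one-sided at the
    endpoints of a closed interval. *)
Definition has_derivative_on (f f' : R -> R) (D : R -> Prop) : Prop :=
  forall x : R, D x -> D_in f f' D x.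

Definition is_minimizer_on (f : R -> R) (D : R -> Prop) (x : R) : Prop :=
  D x /\ forall y : R, D y -> f x <= f y.

Inductive answer : Set := Plus | Minus.

(** No clause covers the case [f x - f y + delta x y = 0]: either answer is
    then allowed. *)
Definition order_oracle
    (f : R -> R) (D : R -> Prop) (Delta : R) (psi : R -> R -> answer) : Prop :=
  exists delta : R -> R -> R,
    forall x y : R, D x -> D y ->
      Rabs (delta x y) <= Delta /\
      (f x - f y + delta x y > 0 -> psi x y = Plus) /\
      (f x - f y + delta x y < 0 -> psi x y = Minus).

Definition golden_step (psi : R -> R -> answer) (I : R * R) : R * R :=
  let (a, b) := I in
  let s := b - (b - a) / phi in
  let t := a + (b - a) / phi in
  match psi s t with
  | Plus => (s, b)
  | Minus => (a, t)
  end.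

(** The endpoints [(a_n, b_n)] of the interval remaining after [n] iterations
    started on [[a, b]]. *)
Fixpoint golden_interval
    (psi : R -> R -> answer) (a b : R) (n : nat) : R * R :=
  match n with
  | O => (a, b)
  | S m => golden_step psi (golden_interval psi a b m)
  end.

Definition golden_output
    (psi : R -> R -> answer) (a b : R) (n : nat) : R :=
  let (an, bn) := golden_interval psi a b n in (an + bn) / 2.

(* Main.v *)
Require Import Defs.
From Stdlib Require Import Reals Lra.
Open Scope R_scope.

(** The theorem splits the error of the output into two independent parts.

    A wrong answer of the oracle may discard every minimizer, but each
    iteration raises the minimum over the remaining interval by at most
    [phi * Delta]. Indeed, if the part beyond the query point [p] is cut off
    while [q] is the other query point, then [f q <= f p + Delta]; convexity
    says that [f] grows at least as fast from [p] to [q] as from a discarded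
    [x] to [p], so [f p - f x] is at most [Delta] times the ratio
    [|p - x| / |q - p|]. For the golden section this ratio never exceeds
    [phi], because [phi * (2 - phi) = phi - 1]. The point [p] itself survives
    as an endpoint ([low_point_survives_step]), so after [n] iterations some
    remaining point is within [n * phi * Delta] of the optimum
    ([golden_interval_invariant]).

    The midpoint is within half of the remaining length [r / phi ^ n0] of that
    point, which costs at most [M * r / (2 * phi ^ n0)] by the Lipschitz bound.
    The constant [C] is chosen so that at [n0] this cost equals
    [phi * Delta / ln phi], and [n0 + 1 / ln phi] is the base-[phi] logarithm of
    [C / Delta], since [n0] is that of [C / (e * Delta)]. *)

Lemma phi_sqr : phi * phi = phi + 1.
Proof.
  unfold phi. pose proof (sqrt_sqrt 5 ltac:(lra)). nra.
Qed.

Lemma phi_bounds : 1 < phi < 2.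
Proof.
  assert (0 <= phi) by (unfold phi; pose proof (sqrt_pos 5); lra).
  pose proof phi_sqr. split; nra.
Qed.

Lemma ln_phi_pos : 0 < ln phi.
Proof.
  rewrite <- ln_1. pose proof phi_bounds. apply ln_increasing; lra.
Qed.

Lemma oracle_plus f D Delta psi x y :
  order_oracle f D Delta psi -> D x -> D y -> psi x y = Plus ->
  f y <= f x + Delta.
Proof.
  intros [delta H] Dx Dy E. destruct (H x y Dx Dy) as (B & _ & N).
  assert (- Delta <= delta x y <= Delta)
    by (revert B; unfold Rabs; destruct (Rcase_abs _); lra).
  destruct (Rlt_le_dec (f x - f y + delta x y) 0) as [Hlt|]; [|lra].
  specialize (N Hlt). congruence.
Qed.

Lemma oracle_minus f D Delta psi x y :
  order_oracle f D Delta psi -> D x -> D y -> psi x y = Minus ->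
  f x <= f y + Delta.
Proof.
  intros [delta H] Dx Dy E. destruct (H x y Dx Dy) as (B & P & _).
  assert (- Delta <= delta x y <= Delta)
    by (revert B; unfold Rabs; destruct (Rcase_abs _); lra).
  destruct (Rlt_le_dec 0 (f x - f y + delta x y)) as [Hgt|]; [|lra].
  specialize (P Hgt). congruence.
Qed.

(** A convex function that rises by at most [Delta] from [p] to [q] cannot have
    risen faster on the way to [p]. Using convex combinations with weights
    [1 / (1 + c)] and [c / (1 + c)] instead of slopes covers both orders
    [x <= p < q] and [q < p <= x] at once. *)
Lemma convex_backward_drop f D x p q c Delta :
  convex_on f D -> D x -> D q -> 0 <= c -> p - x = c * (q - p) ->
  f q <= f p + Delta -> f p <= f x + c * Delta.
Proof.
  intros Hf Dx Dq Hc E Hq.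
  assert (Hinv : 0 < / (1 + c) <= 1).
  { split; [apply Rinv_0_lt_compat; lra|].
    rewrite <- Rinv_1. apply Rinv_le_contravar; lra. }
  pose proof (Hf x q (/ (1 + c)) Dx Dq ltac:(lra)) as H.
  replace (/ (1 + c) * x + (1 - / (1 + c)) * q) with p in H.
  2:{ replace x with (p - c * (q - p)) by lra. field. lra. }
  apply (Rmult_le_compat_l (1 + c)) in H; [|lra].
  replace ((1 + c) * (/ (1 + c) * f x + (1 - / (1 + c)) * f q))
    with (f x + c * f q) in H by (field; lra).
  nra.
Qed.

Lemma convex_backward_drop_le f D x p q k Delta :
  convex_on f D -> D x -> D q -> p <> q -> 0 <= Delta ->
  0 <= (p - x) / (q - p) <= k ->
  f q <= f p + Delta -> f p <= f x + k * Delta.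
Proof.
  intros Hf Dx Dq Hpq HDelta Hc Hq.
  assert (f p <= f x + (p - x) / (q - p) * Delta).
  { apply (convex_backward_drop f D x p q); auto; try lra. field. lra. }
  nra.
Qed.

Lemma Rdiv_between u v k : 0 < v -> 0 <= u <= k * v -> 0 <= u / v <= k.
Proof.
  intros Hv Hu. split.
  - apply Rmult_le_pos; [lra|]. left. apply Rinv_0_lt_compat, Hv.
  - apply Rmult_le_reg_r with v; [exact Hv|]. unfold Rdiv.
    rewrite Rmult_assoc, Rinv_l by lra. lra.
Qed.

Lemma golden_step_geometry psi a b a' b' :
  a < b -> golden_step psi (a, b) = (a', b') ->
  a <= a' /\ a' < b' /\ b' <= b /\ (b' - a') * phi = b - a.
Proof.
  intros Hab E. unfold golden_step in E. pose proof phi_bounds.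
  assert (Hw : (b - a) / phi * phi = b - a) by (field; lra).
  set (w := (b - a) / phi) in *. clearbody w.
  assert (0 < w < b - a) by nra.
  destruct (psi _ _); injection E; intros; subst; repeat split; lra.
Qed.

(** What is lost when [x] is discarded: the query point next to it becomes an
    endpoint of the new interval and replaces it. *)
Lemma low_point_survives_step f psi D Delta a b a' b' x :
  convex_on f D -> order_oracle f D Delta psi -> 0 <= Delta ->
  (forall z, Icc a b z -> D z) -> a < b ->
  golden_step psi (a, b) = (a', b') -> Icc a b x ->
  exists y, Icc a' b' y /\ f y <= f x + phi * Delta.
Proof.
  intros Hf Hpsi HDelta Hsub Hab E [Hax Hxb].
  pose proof phi_bounds as Hphi. pose proof phi_sqr as Hsqr.
  unfold golden_step in E.
  assert (Hw : (b - a) / phi * phi = b - a) by (field; lra).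
  set (w := (b - a) / phi) in *. clearbody w.
  assert (Hw0 : 0 < w) by nra.
  assert (w < b - a) by nra.
  assert (0 < a + w - (b - w)) by nra.
  (* The distance from a query point to the nearer endpoint is [phi] times the
     distance between the query points. *)
  assert (Hratio : b - w - a = phi * (a + w - (b - w))).
  { replace b with (a + w * phi) by lra.
    replace (a + w - (a + w * phi - w)) with (w * 2 - w * phi) by ring.
    replace (phi * (w * 2 - w * phi)) with (2 * phi * w - w * (phi * phi))
      by ring.
    rewrite Hsqr. ring. }
  assert (0 <= phi * Delta) by (apply Rmult_le_pos; lra).
  assert (Ds : D (b - w)) by (apply Hsub; unfold Icc; lra).
  assert (Dt : D (a + w)) by (apply Hsub; unfold Icc; lra).
  assert (Dx : D x) by (apply Hsub; unfold Icc; lra).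
  destruct (psi _ _) eqn:A; injection E; intros; subst a' b'.
  - destruct (Rle_lt_dec (b - w) x).
    + exists x. unfold Icc. lra.
    + exists (b - w). split; [unfold Icc; lra|].
      apply (convex_backward_drop_le f D x _ (a + w)); auto; try lra.
      * apply Rdiv_between; lra.
      * exact (oracle_plus f D Delta psi _ _ Hpsi Ds Dt A).
  - destruct (Rle_lt_dec x (a + w)).
    + exists x. unfold Icc. lra.
    + exists (a + w). split; [unfold Icc; lra|].
      apply (convex_backward_drop_le f D x _ (b - w)); auto; try lra.
      * replace ((a + w - x) / (b - w - (a + w)))
          with ((x - (a + w)) / (a + w - (b - w))) by (field; lra).
        apply Rdiv_between; lra.
      * exact (oracle_minus f D Delta psi _ _ Hpsi Ds Dt A).
Qed.

Lemma golden_interval_invariant f psi a b Delta n an bn :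
  convex_on f (Icc a b) -> order_oracle f (Icc a b) Delta psi ->
  0 <= Delta -> a < b -> golden_interval psi a b n = (an, bn) ->
  a <= an /\ an < bn /\ bn <= b /\ (bn - an) * phi ^ n = b - a /\
  forall x, Icc a b x ->
    exists y, Icc an bn y /\ f y <= f x + INR n * (phi * Delta).
Proof.
  intros Hf Hpsi HDelta Hab. revert an bn.
  induction n as [|n IH]; intros an bn E.
  - injection E; intros; subst. repeat split; try lra.
    intros x Hx. exists x. split; [exact Hx|]. simpl. lra.
  - simpl golden_interval in E.
    destruct (golden_interval psi a b n) as [c d].
    destruct (IH c d eq_refl) as (Hac & Hcd & Hdb & Hlen & Hlow).
    destruct (golden_step_geometry psi c d an bn Hcd E) as (? & ? & ? & Hlen').
    repeat split; try lra.
    + rewrite <- Hlen, <- Hlen'. simpl. ring.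
    + intros x Hx. destruct (Hlow x Hx) as (y & Hy & Hfy).
      destruct (low_point_survives_step f psi (Icc a b) Delta c d an bn y)
        as (z & Hz & Hfz); auto.
      { intros u [Hu1 Hu2]. unfold Icc. lra. }
      exists z. split; [exact Hz|]. rewrite S_INR. lra.
Qed.

(** As a function on the whole line, [f] may be discontinuous at the endpoints,
    so the extreme value theorem is applied to [f] composed with the projection
    onto the interval, which is Lipschitz everywhere. *)
Lemma lipschitz_has_minimizer K f a b :
  0 < K -> a <= b -> lipschitz_on K f (Icc a b) ->
  exists x, is_minimizer_on f (Icc a b) x.
Proof.
  intros HK Hab Hf.
  set (clamp := fun x => Rmax a (Rmin b x)).
  assert (Hin : forall x, Icc a b (clamp x)).
  { intros x. unfold Icc, clamp, Rmax, Rmin.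
    destruct (Rle_dec b x), (Rle_dec a _); lra. }
  assert (Hid : forall x, Icc a b x -> clamp x = x).
  { intros x [H1 H2]. unfold clamp.
    rewrite Rmin_right, Rmax_right; lra. }
  assert (Hcontr : forall x y, Rabs (clamp x - clamp y) <= Rabs (x - y)).
  { intros x y. unfold clamp, Rmax, Rmin.
    destruct (Rle_dec b x), (Rle_dec b y);
      repeat destruct (Rle_dec a _); unfold Rabs;
      repeat destruct (Rcase_abs _); lra. }
  destruct (continuity_ab_min (fun x => f (clamp x)) a b Hab) as (m & Hm & HmI).
  { intros c _ eps Heps. exists (eps / K). split.
    { apply Rdiv_lt_0_compat; lra. }
    intros x [_ Hx]. simpl in *. unfold Rdist in *.
    apply Rle_lt_trans with (K * Rabs (clamp x - clamp c)); [apply Hf; auto|].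
    apply Rle_lt_trans with (K * Rabs (x - c)).
    { apply Rmult_le_compat_l; [lra|apply Hcontr]. }
    replace eps with (K * (eps / K)) by (field; lra).
    apply Rmult_lt_compat_l; assumption. }
  exists m. split; [exact HmI|]. intros y Hy.
  specialize (Hm y Hy). simpl in Hm. rewrite !Hid in Hm by assumption.
  exact Hm.
Qed.

Lemma pow_of_Rlog b x n :
  0 < b -> ln b <> 0 -> 0 < x -> INR n = Rlog b x -> b ^ n = x.
Proof.
  intros Hb Hln Hx E. apply ln_inv; [apply pow_lt, Hb|exact Hx|].
  rewrite ln_pow by exact Hb. rewrite E. unfold Rlog. field. exact Hln.
Qed.

(** The error guarantee for an arbitrary number of iterations; the logarithmic
    bound is its value at [n0]. *)
Lemma golden_output_error f psi a b M Delta n x :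
  convex_on f (Icc a b) -> order_oracle f (Icc a b) Delta psi ->
  lipschitz_on M f (Icc a b) -> 0 <= M -> 0 <= Delta -> a < b -> Icc a b x ->
  f (golden_output psi a b n) - f x
    <= INR n * (phi * Delta) + M * ((b - a) / (2 * phi ^ n)).
Proof.
  intros Hf Hpsi HM HM0 HDelta Hab Hx. unfold golden_output.
  destruct (golden_interval psi a b n) as [an bn] eqn:E.
  destruct (golden_interval_invariant f psi a b Delta n an bn)
    as (? & ? & ? & Hlen & Hlow); auto.
  destruct (Hlow x Hx) as (y & [Hy1 Hy2] & Hfy).
  assert (0 < phi ^ n) by (apply pow_lt; pose proof phi_bounds; lra).
  replace ((b - a) / (2 * phi ^ n)) with ((bn - an) / 2)
    by (rewrite <- Hlen; field; lra).
  assert (Hmid : f ((an + bn) / 2) - f y <= M * Rabs ((an + bn) / 2 - y)).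
  { eapply Rle_trans; [apply Rle_abs|]. apply HM; unfold Icc; lra. }
  assert (Rabs ((an + bn) / 2 - y) <= (bn - an) / 2) by (apply Rabs_le; lra).
  assert (M * Rabs ((an + bn) / 2 - y) <= M * ((bn - an) / 2))
    by (apply Rmult_le_compat_l; assumption).
  lra.
Qed.

Theorem theorem1
  (r M L Delta : R) (f f' : R -> R) (psi : R -> R -> answer) (C : R) (n0 : nat)
  (Hr : 0 < r) (HM : 0 < M) (HL : 0 < L) (HDelta : 0 < Delta)
  (Hconvex : convex_on f (Icc 0 r))
  (Hderiv : has_derivative_on f f' (Icc 0 r))
  (HlipM : lipschitz_on M f (Icc 0 r))
  (HlipL : lipschitz_on L f' (Icc 0 r))
  (HC : C = exp 1 * r * M * ln phi / (2 * phi))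
  (Hn0 : INR n0 = Rlog phi (C / (exp 1 * Delta)))
  (Hpsi : order_oracle f (Icc 0 r) Delta psi) :
  exists xmin : R,
    is_minimizer_on f (Icc 0 r) xmin /\
    f (golden_output psi 0 r n0) - f xmin <= phi * Delta * Rlog phi (C / Delta).
Proof.
  pose proof phi_bounds as Hphi. pose proof ln_phi_pos as Hln.
  pose proof (exp_pos 1) as He.
  destruct (lipschitz_has_minimizer M f 0 r) as (xmin & Hmin); auto; [lra|].
  exists xmin. split; [exact Hmin|].
  eapply Rle_trans.
  { apply (golden_output_error f psi 0 r M Delta n0 xmin); auto; try lra.
    apply Hmin. }
  assert (HC0 : 0 < C).
  { rewrite HC. apply Rdiv_lt_0_compat; [|lra].
    repeat apply Rmult_lt_0_compat; assumption. }
  assert (HX : 0 < C / (exp 1 * Delta)).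
  { apply Rdiv_lt_0_compat; [exact HC0|].
    apply Rmult_lt_0_compat; assumption. }
  assert (Hlog : Rlog phi (C / Delta) = INR n0 + / ln phi).
  { rewrite Hn0. unfold Rlog.
    replace (C / Delta) with (C / (exp 1 * Delta) * exp 1) by (field; lra).
    rewrite ln_mult, ln_exp by assumption. field. lra. }
  rewrite Hlog, (pow_of_Rlog phi (C / (exp 1 * Delta)) n0) by (auto; lra).
  rewrite HC. right. field. lra.
Qed.
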